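(* For every integer $r \ge 2$ and every real $\epsilon$ with $0 < \epsilon < \frac{1}{r}$ there exists $n_0=n_0(r,\epsilon)$ such that for every integer $n>n_0$, $$ b_n(r,1/r-\epsilon) \leq \frac{10\log n}{\epsilon\, r \log r }\;. $$
   Context: Graphs are finite and simple. For positive integers $k,b$, $K_{k}(b)$ (the $b$-blow-up of the complete graph $K_k$) is the graph consisting of $k$ disjoint vertex sets $V_1,\ldots,V_{k}$ of size $b$ each, where for every $i \neq j$ every vertex of $V_i$ is adjacent to every vertex of $V_j$. For an integer $r\ge 2$ and real $0<\delta<1/r$, $b_n(r,\delta)$ denotes the largest integer $b$ such that every $n$-vertex graph with at least $(1-1/r+\delta)n^2/2$ edges contains a copy of $K_{r+1}(b)$ as a (not necessarily induced) subgraph. In particular, $b_n(r,1/r-\epsilon)$ concerns $n$-vertex graphs with at least $(1-\epsilon)n^2/2$ edges. Floor and ceiling signs are omitted, since they are immaterial for the asymptotic estimates. *)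

(* Defs.v *)
From HB Require Import structures.
From mathcomp Require Import all_boot all_order all_algebra.
From mathcomp Require Import all_classical all_reals all_analysis.

Set Implicit Arguments.
Unset Strict Implicit.
Unset Printing Implicit Defensive.

Import Order.TTheory GRing.Theory Num.Theory.

Local Open Scope ring_scope.

Record sgraph := SGraph {
  vertex :> finType;
  adj : rel vertex;
  adj_sym : symmetric adj;
  adj_irr : irreflexive adj
}.

Definition edges (G : sgraph) : {set {set G}} :=
  [set [set x; y] | x in G, y in G & adj x y].

Section Blowup.
Variables k b : nat.

Definition blowup_rel : rel ('I_k * 'I_b)%type := fun u v => u.1 != v.1.

Lemma blowup_sym : symmetric blowup_rel.
Proof. by move=> u v; rewrite /blowup_rel eq_sym. Qed.

Lemma blowup_irr : irreflexive blowup_rel.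
Proof. by move=> u; rewrite /blowup_rel eqxx. Qed.

Definition blowup : sgraph := SGraph blowup_sym blowup_irr.

End Blowup.

(* Copies are not necessarily induced. *)
Definition contains_copy (G H : sgraph) : Prop :=
  exists2 f : H -> G, injective f & forall x y : H, adj x y -> adj (f x) (f y).

Definition forces_blowup (R : realType) (n r : nat) (delta : R) (b : nat) : Prop :=
  forall G : sgraph, #|G| = n ->
    (1 - r%:R^-1 + delta) * n%:R ^+ 2 / 2 <= #|edges G|%:R ->
    contains_copy G (blowup r.+1 b).

(* [is_bn n r delta b] says b = b_n(r, delta).  It is a relation because no
   largest b exists when no n-vertex graph meets the edge bound (small n).  The
   value b = 0 is allowed; since b = 1 is always forced for 0 < delta and
   0 < n (Turan), this does not change the maximum. *)
Definition is_bn (R : realType) (n r : nat) (delta : R) (b : nat) : Prop :=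
  forces_blowup n r delta b /\
  forall c : nat, forces_blowup n r delta c -> (c <= b)%N.

(* Main.v *)
Require Import Defs.
From HB Require Import structures.
From mathcomp Require Import all_boot all_order all_algebra.
From mathcomp Require Import all_classical all_reals all_analysis.
From mathcomp Require Import zify ring lra.

Import Order.TTheory GRing.Theory Num.Theory.

(** The graphs that avoid large blow-ups are random, but their edges are not
    independent.  Colour the n vertices independently and uniformly with q
    colours, do this m times, and join two vertices when they receive different
    colours in every one of the m colourings.  Two distinct vertices are
    non-adjacent with probability at most m/q, so m/q = eps/2 leaves enough room
    for the required number of edges.

    Write k = r+1 and let f be an injection of the k*b vertices of K_k(b).  For
    f to be a copy, each colouring must use disjoint sets of colours on the k
    parts, that is, some map from the q colours to the k parts must send the
    colour of every vertex of the copy to its part.  There are k^q such maps,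
    and by the inequality between arithmetic and geometric means each of them
    is respected with probability at most k^(-kb) (card_labelled).  So one
    colouring separates the parts with probability at most k^(q - kb)
    (card_separates), and the expected number of copies is at most
    n^(kb) * k^((q - kb) m).

    If n^2 <= k^m, which asks for m of order 2 log n / log r, half of the
    exponent k*b*m pays for the n^(kb) choices of f, and the expectation is
    small as soon as k*b > 2q.  Since q = 2m/eps is about
    4 log n / (eps log r), this reaches every b above roughly
    8 log n / (eps r log r), and the constant 10 absorbs the rounding.  The
    factor log r comes from the number of colours being comparable with the
    number of vertices of the blow-up: independent edges of density 1 - eps
    would only give 2 log n / (eps r).

    The probabilities are expressed as cardinalities multiplied out, and
    exists_unseparated_colorings combines the two expectations. *)

Set Implicit Arguments.
Unset Strict Implicit.
Unset Printing Implicit Defensive.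

Local Open Scope ring_scope.
Local Open Scope nat_scope.

(** * Counting in finite types *)

(** The inequality between geometric and arithmetic means, cleared of roots and
    denominators. *)
Lemma prod_leq_exp_sum (I : finType) (E : I -> nat) :
  (\prod_i E i) * #|I| ^ #|I| <= (\sum_i E i) ^ #|I|.
Proof.
have [I0|I_gt0] := posnP #|I|.
  by rewrite I0 !expn0 muln1 big_pred0 // => i; have := card0_eq I0 i.
have [/= agm _] :=
  @leif_AGM rat I predT (fun i => (E i)%:R)%R (fun i _ => ler0n _ _).
move: agm; rewrite -natr_prod -natr_sum expr_div_n.
rewrite ler_pdivlMr ?exprn_gt0 ?ltr0n //.
by rewrite -!natrX -natrM ler_nat.
Qed.

(** The union bound. *)
Lemma card_exists_leq (I T : finType) (P : I -> pred T) :
  #|[set t | [exists i, P i t]]| <= \sum_i #|[set t | P i t]|.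
Proof.
rewrite -sum1dep_card.
under [leqRHS]eq_bigr => i _ do rewrite -sum1dep_card big_mkcond.
rewrite exchange_big big_mkcond; apply: leq_sum => t _.
case: existsP => // -[i Pit].
by rewrite (bigD1 i) //= Pit.
Qed.

Lemma card_familyE (aT rT : finType) (F : aT -> pred rT) :
  #|family F| = \prod_x #|F x|.
Proof. by rewrite card_family foldrE big_image. Qed.

(** One value of a uniformly random function is uniformly distributed. *)
Lemma card_ffun_at (aT rT : finType) (P : pred rT) (a : aT) :
  #|[set h : {ffun aT -> rT} | P (h a)]| * #|rT| = #|P| * #|{ffun aT -> rT}|.
Proof.
have -> : #|[set h : {ffun aT -> rT} | P (h a)]| =
    #|family (fun b => if b == a then P else predT : pred rT)|.
  apply: eq_card => h; rewrite inE; apply/idP/familyP => [Pha b|/(_ a)].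
    by case: eqP => // ->.
  by rewrite eqxx.
rewrite card_familyE (bigD1 a) //= eqxx -mulnA; congr (_ * _).
rewrite (eq_bigr (fun=> #|rT|)) => [|b /negbTE -> //].
rewrite prod_nat_const card_ffun mulnC -expnS; congr (_ ^ _).
by rewrite cardC1 prednK //; apply/card_gt0P; exists a.
Qed.

(** * One random colouring *)

Section Coloring.
Variables V C : finType.

(** Recolouring x arbitrarily loses no information on a colouring that gives x
    and y the same colour, since y still shows the old colour of x. *)
Lemma card_monochromatic_pair (x y : V) : x != y ->
  #|[set c : {ffun V -> C} | c x == c y]| * #|C| <= #|{ffun V -> C}|.
Proof.
move=> neq_xy.
pose recolor (p : {ffun V -> C} * C) : {ffun V -> C} :=
  [ffun z => if z == x then p.2 else p.1 z].
rewrite -cardsT -cardsX -(card_in_imset (f := recolor)) ?max_card //.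
move=> [c a] [d e]; rewrite !inE /= !andbT => /eqP cxy /eqP dxy.
move=> /ffunP eq_r.
have eqcd z : z != x -> c z = d z.
  by move=> nzx; have := eq_r z; rewrite !ffunE (negbTE nzx).
have -> : a = e by have := eq_r x; rewrite !ffunE eqxx.
congr (_, _); apply/ffunP => z.
have [->|/eqcd //] := eqVneq z x.
by rewrite cxy dxy eqcd // eq_sym.
Qed.

Definition separates k b (f : 'I_k * 'I_b -> V) (c : {ffun V -> C}) :=
  [forall u, forall v, (u.1 != v.1) ==> (c (f u) != c (f v))].

(** If g has a_i colours with label i, then the vertices of the i-th part have
    a_i admissible colours each, so the image of f can be coloured in
    (\prod_i a_i)^b ways; as the a_i add up to #|C|, this is largest when they
    are equal. *)
Lemma card_labelled k b (f : 'I_k * 'I_b -> V) (g : {ffun C -> 'I_k}) :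
  injective f ->
  #|[set c : {ffun V -> C} | [forall u, g (c (f u)) == u.1]]| * k ^ (k * b)
  <= #|C| ^ #|V|.
Proof.
move=> f_inj.
pose F (x : V) : pred C := fun a => [forall u, (f u == x) ==> (g a == u.1)].
have -> : #|[set c : {ffun V -> C} | [forall u, g (c (f u)) == u.1]]| =
          #|family F|.
  apply: eq_card => c; rewrite inE; apply/forallP/familyP => [cP x|cP u].
    by apply/forallP => u; apply/implyP => /eqP <-.
  by have /forallP/(_ u) := cP (f u); rewrite eqxx.
rewrite card_familyE (bigID [in f @: predT]) /=.
rewrite big_imset /=; last by move=> u v _ _; apply: f_inj.
pose E (i : 'I_k) := #|[set a | g a == i]|.
have -> : \prod_(u in predT) #|F (f u)| = (\prod_i E i) ^ b.
  transitivity (\prod_i \prod_j #|F (f (i, j))|).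
    by rewrite pair_big; apply: eq_big => -[i j].
  rewrite (big_morph (expn^~ b) (fun m n => expnMn m n b) (exp1n b)).
  apply: eq_bigr => i _.
  under eq_bigr => j _.
    rewrite (_ : #|_| = E i); first over.
    apply: eq_card => a; rewrite !inE; apply/forallP/idP => [/(_ (i, j))|ga u].
      by rewrite eqxx.
    by apply/implyP => /eqP/f_inj ->.
  by rewrite prod_nat_const card_ord.
have -> : \prod_(x | x \notin f @: predT) #|F x| = #|C| ^ (#|V| - k * b).
  have -> : #|V| - k * b = #|[pred x | x \notin f @: predT]|.
    have := cardC [in f @: predT].
    rewrite card_imset // card_prod !card_ord => <-.
    by rewrite addKn.
  rewrite -prod_nat_const; apply: eq_bigr => x fx.
  apply: eq_card => a; rewrite !inE; apply/forallP => u.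
  by apply/implyP => /eqP fux; move: fx; rewrite -fux imset_f.
have le_kb : k * b <= #|V|.
  have := max_card [in f @: predT].
  by rewrite card_imset // card_prod !card_ord.
rewrite mulnAC -[in leqRHS](subnKC le_kb) expnD leq_mul2r; apply/orP; right.
have expn_mono e m n : m <= n -> m ^ e <= n ^ e.
  by case: e => // e; rewrite leq_exp2r.
rewrite !expnM -expnMn; apply/expn_mono.
have := prod_leq_exp_sum E; rewrite card_ord => /leq_trans; apply.
apply/expn_mono.
rewrite /E; under eq_bigr do rewrite -sum1dep_card.
by rewrite -[leqRHS]sum1_card [leqRHS](partition_big g predT).
Qed.

(** A separating colouring assigns each colour to at most one part; colours that
    do not occur on the copy can be labelled at will.  Hence every separating
    colouring respects one of the k ^ #|C| labellings of the colours. *)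
Lemma card_separates k b (f : 'I_k * 'I_b -> V) :
  0 < k -> injective f ->
  #|[set c | separates f c]| * k ^ (k * b) <= k ^ #|C| * #|C| ^ #|V|.
Proof.
case: k f => // k f _ f_inj.
pose label (g : {ffun C -> 'I_k.+1}) (c : {ffun V -> C}) :=
  [forall u, g (c (f u)) == u.1].
have le_label :
    #|[set c | separates f c]| <= \sum_g #|[set c | label g c]|.
  apply: leq_trans (card_exists_leq label); apply: subset_leq_card.
  apply/fintype.subsetP => c; rewrite !inE => /forallP sep_c; apply/existsP.
  exists [ffun a => odflt ord0 (omap fst [pick u | c (f u) == a])].
  apply/forallP => u; rewrite ffunE.
  case: pickP => [v|/(_ u)]; last by rewrite eqxx.
  move=> /eqP cfv; apply: contraTT isT => /= neq.
  by have /forallP/(_ u)/implyP/(_ neq) := sep_c v; rewrite cfv eqxx.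
apply: leq_trans (leq_mul le_label (leqnn _)) _.
rewrite big_distrl /= -[k.+1 in leqRHS]card_ord -card_ffun -sum_nat_const.
by apply: leq_sum => g _; apply: card_labelled.
Qed.

End Coloring.

(** * Several independent colourings *)

Section RandomColorings.
Variables (V C : finType) (m : nat).
Implicit Types (w : {ffun 'I_m -> {ffun V -> C}}) (x y : V).

(** The condition x != y makes the relation irreflexive also when m = 0. *)
Definition all_differ w : rel V :=
  fun x y => (x != y) && [forall j, w j x != w j y].

(** The expected number of non-adjacent ordered pairs: the diagonal contributes
    #|V|, and each other pair at most m / #|C| by a union bound over the
    colourings. *)
Lemma sum_not_all_differ :
  (\sum_w #|[set p : V * V | ~~ all_differ w p.1 p.2]|) * #|C| <=
  (#|V| * #|C| + m * #|V| ^ 2) * #|{ffun 'I_m -> {ffun V -> C}}|.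
Proof.
under eq_bigr do rewrite -sum1dep_card big_mkcond.
rewrite exchange_big big_distrl /=.
set O := #|{ffun 'I_m -> {ffun V -> C}}|.
have le_pair (p : V * V) :
    (\sum_w if ~~ all_differ w p.1 p.2 then 1 else 0) * #|C| <=
    (p.1 == p.2) * #|C| * O + m * O.
  rewrite -big_mkcond sum1dep_card; have [_|neq] := eqVneq p.1 p.2.
    apply: leq_trans (leq_addr _ _).
    by rewrite mul1n mulnC leq_mul2l max_card orbT.
  rewrite mul0n add0n.
  pose mono (j : 'I_m) w := w j p.1 == w j p.2.
  have -> : #|[set w | ~~ all_differ w p.1 p.2]| =
            #|[set w | [exists j, mono j w]]|.
    apply: eq_card => w; rewrite !inE /all_differ neq /= negb_forall.
    by apply: eq_existsb => j; rewrite negbK.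
  apply: leq_trans (leq_mul (card_exists_leq mono) (leqnn _)) _.
  rewrite big_distrl /= -[m in leqRHS]card_ord -sum_nat_const.
  apply: leq_sum => j _.
  pose P (c : {ffun V -> C}) := c p.1 == c p.2.
  have := card_ffun_at P j; have := card_monochromatic_pair C neq.
  rewrite -/(mono j) cardsE => le_P eq_P.
  have [F0|F_gt0] := posnP #|{ffun V -> C}|.
    rewrite (_ : #|[set w | mono j w]| = 0) //; apply: eq_card0 => w.
    by have := card0_eq F0 (w j); rewrite inE.
  rewrite -(leq_pmul2r F_gt0) mulnAC eq_P mulnAC [leqRHS]mulnC.
  by rewrite leq_mul2r le_P orbT.
apply: (@leq_trans (\sum_(p : V * V) ((p.1 == p.2) * #|C| * O + m * O))).
  by apply: leq_sum => p _; apply: le_pair.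
rewrite big_split /= sum_nat_const -big_distrl -big_distrl /= mulnDl.
apply: leq_add.
  rewrite leq_mul2r leq_mul2r; apply/orP; right; apply/orP; right.
  rewrite -(pair_big predT predT (fun x y => (x == y) : nat)) /=.
  rewrite -sum1_card; apply: leq_sum => x _.
  rewrite (bigD1 x) //= eqxx big1 // => y.
  by rewrite eq_sym => /negbTE ->.
by rewrite card_prod mulnA [_ * m]mulnC.
Qed.

(** The m colourings are independent, so the bound for one of them is raised to
    the power m. *)
Lemma card_all_separate k b (f : 'I_k * 'I_b -> V) :
  0 < k -> injective f ->
  #|[set w : {ffun 'I_m -> {ffun V -> C}} | [forall j, separates f (w j)]]|
    * k ^ (k * b * m) <=
  k ^ (#|C| * m) * #|{ffun 'I_m -> {ffun V -> C}}|.
Proof.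
move=> k_gt0 f_inj.
have -> :
    #|[set w : {ffun 'I_m -> {ffun V -> C}} | [forall j, separates f (w j)]]| =
    #|[set c : {ffun V -> C} | separates f c]| ^ m.
  rewrite -[m in RHS]card_ord -card_ffun_on; apply: eq_card => w.
  rewrite inE; apply/forallP/ffun_onP => sep_w j; have := sep_w j;
    by rewrite inE.
rewrite !card_ffun card_ord !expnM -!expnMn.
have := card_separates C k_gt0 f_inj; case: m => // e.
by rewrite expnM leq_exp2r.
Qed.

(** The spare 2 in 2q + 2 <= kb, where q = #|C|, brings the expected number of
    separated injections down to 1 / k ^ m <= 1/5.  By Markov's inequality, the
    number of non-adjacent pairs exceeds 4/3 of the bound on its expectation
    with probability at most 3/4.  As 1/5 + 3/4 < 1, some choice of colourings
    escapes both events. *)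
Lemma exists_unseparated_colorings k b :
  0 < #|V| -> 0 < #|C| -> 4 < k ^ m -> #|V| ^ 2 <= k ^ m ->
  2 * #|C| + 2 <= k * b ->
  exists w, 3 * #|C| * #|[set p : V * V | ~~ all_differ w p.1 p.2]| <=
              4 * (#|V| * #|C| + m * #|V| ^ 2)
    /\ forall f : 'I_k * 'I_b -> V, injective f ->
         ~~ [forall j, separates f (w j)].
Proof.
set n := #|V|; set q := #|C| => n_gt0 q_gt0 km_gt4 n2_le kb_ge.
have k_gt0 : 0 < k by case: k kb_ge {km_gt4 n2_le} => //; rewrite mul0n addn2.
set O := #|{ffun 'I_m -> {ffun V -> C}}|.
have O_gt0 : 0 < O by rewrite /O !card_ffun !expn_gt0 q_gt0.
pose S w (f : {ffun 'I_k * 'I_b -> V}) :=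
  injectiveb f && [forall j, separates f (w j)].
pose Y w := #|[set p : V * V | ~~ all_differ w p.1 p.2]|.
set T := 4 * (n * q + m * n ^ 2).
pose bad1 := [set w | [exists f, S w f]].
pose bad2 := [set w | T < 3 * q * Y w].
have le_bad1 : #|bad1| * k ^ m <= O.
  have le1 : #|bad1| * k ^ (k * b * m) <= n ^ (k * b) * (k ^ (q * m) * O).
    apply: leq_trans (leq_mul (card_exists_leq (fun f w => S w f)) (leqnn _)) _.
    rewrite big_distrl /=.
    have -> : n ^ (k * b) = #|{ffun 'I_k * 'I_b -> V}|.
      by rewrite card_ffun card_prod !card_ord.
    rewrite -sum_nat_const; apply: leq_sum => f _.
    have [f_inj|f_ninj] := boolP (injectiveb f); last first.
      rewrite (_ : #|[set w | S w f]| = 0) //; apply: eq_card0 => w.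
      by rewrite !inE /S (negbTE f_ninj).
    apply: leq_trans (card_all_separate k_gt0 (injectiveP _ f_inj)).
    rewrite leq_mul2r subset_leq_card ?orbT //.
    by apply/fintype.subsetP => w; rewrite !inE => /andP[].
  (* Squaring turns the number of injections into a power of n ^ 2 <= k ^ m. *)
  have le2 : n ^ (k * b) * k ^ (q * m) * k ^ m <= k ^ (k * b * m).
    rewrite -(@leq_exp2r _ _ 2) // !expnMn -!expnM.
    have -> : k * b * 2 = 2 * (k * b) by rewrite mulnC.
    rewrite expnM.
    have le3 : (n ^ 2) ^ (k * b) <= k ^ (m * (k * b)).
      rewrite [leqRHS]expnM leq_exp2r //.
      by apply: leq_trans kb_ge; rewrite addn2.
    apply: leq_trans (leq_mul (leq_mul le3 (leqnn _)) (leqnn _)) _.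
    rewrite -!expnD leq_pexp2l //.
    by have := leq_mul kb_ge (leqnn m); lia.
  have D_gt0 : 0 < n ^ (k * b) * k ^ (q * m).
    by rewrite muln_gt0 !expn_gt0 n_gt0 k_gt0.
  rewrite -(leq_pmul2l D_gt0) mulnCA.
  apply: leq_trans (leq_mul (leqnn _) le2) _.
  by rewrite mulnA in le1.
have le_bad2 : 4 * #|bad2| <= 3 * O.
  have sumY := sum_not_all_differ.
  have : \sum_(w in bad2) T.+1 <= \sum_w 3 * q * Y w.
    rewrite big_mkcond; apply: leq_sum => w _.
    by rewrite inE; case: ifP.
  rewrite sum_nat_const -big_distrr /= => le_T.
  rewrite -(leq_pmul2r (ltn0Sn T)); apply: leq_trans (_ : 3 * T * O <= _).
    move: le_T sumY; rewrite -/n -/q -/O.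
    move: (\sum_w _) => SY le_T sumY.
    rewrite -mulnA; apply: leq_trans (leq_mul (leqnn 4) le_T) _.
    have := leq_mul (leqnn 12) sumY; rewrite /T; move: (_ + _) => A; lia.
  by rewrite mulnAC leq_mul2l leqnSn orbT.
have [w] : exists w, w \notin bad1 :|: bad2.
  apply/existsP; apply: contraTT isT => /existsPn all_bad.
  have : O <= #|bad1 :|: bad2|.
    apply: subset_leq_card; apply/fintype.subsetP => w _.
    by have := all_bad w; rewrite negbK.
  have le5 : #|bad1| * 5 <= O.
    by apply: leq_trans le_bad1; rewrite leq_mul2l km_gt4 orbT.
  by have [le_U _] := leq_card_setU bad1 bad2; lia.
rewrite !inE negb_or -leqNgt => /andP[/existsPn noS le_Y].
exists w; split=> // f f_inj; have := noS (finfun f).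
rewrite /S negb_and => /orP[/injectiveP[]|].
  by move=> u v; rewrite !ffunE => /f_inj.
apply: contra => /forallP sep; apply/forallP => j.
apply/forallP => u; apply/forallP => v; rewrite !ffunE.
by have /forallP/(_ u)/forallP := sep j.
Qed.

End RandomColorings.

(** * The graph of a family of colourings *)

Section DifferGraph.
Variables (V C : finType) (m : nat) (w : {ffun 'I_m -> {ffun V -> C}}).

Lemma all_differ_sym : symmetric (all_differ w).
Proof.
move=> x y; rewrite /all_differ eq_sym; congr (_ && _).
by apply: eq_forallb => j; rewrite eq_sym.
Qed.

Lemma all_differ_irr : irreflexive (all_differ w).
Proof. by move=> x; rewrite /all_differ eqxx. Qed.

Definition differ_graph : sgraph := SGraph all_differ_sym all_differ_irr.

Lemma differ_graph_copy k b :
  contains_copy differ_graph (blowup k b) ->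
  exists2 f : 'I_k * 'I_b -> V, injective f & [forall j, separates f (w j)].
Proof.
case=> f f_inj f_adj; exists f => //; apply/forallP => j.
apply/forallP => u; apply/forallP => v; apply/implyP => uv.
by have /andP[_ /forallP] := f_adj u v uv.
Qed.

End DifferGraph.

(** An edge has only two orderings. *)
Lemma card_adjacent_pairs (G : sgraph) :
  #|[set p : G * G | adj p.1 p.2]| <= 2 * #|edges G|.
Proof.
pose ends (p : G * G) : {set G} := [set p.1; p.2].
rewrite mulnC -sum_nat_const -sum1dep_card (partition_big ends [in edges G]) /=;
  last by move=> [x y] /= xy; apply/imset2P; exists x y; rewrite ?inE.
apply: leq_sum => e _; rewrite sum1dep_card.
have [[x y]|none] := pickP (fun p : G * G => adj p.1 p.2 && (ends p == e));
  last by rewrite eq_card0 // => p; rewrite inE none.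
move=> /= /andP[_ /eqP <-].
apply: (@leq_trans #|[set (x, y); (y, x)]|); last by rewrite cards2 ltnS leq_b1.
apply: subset_leq_card; apply/fintype.subsetP => -[a b].
rewrite !inE /= => /andP[ab /eqP/setP eq_e].
have := eq_e a; have := eq_e b; have := eq_e x; have := eq_e y.
rewrite !inE !xpair_eqE /= !eqxx /= ?orbT.
have: a != b by apply: contraTneq ab => ->; rewrite adj_irr.
rewrite [x == a]eq_sym [y == a]eq_sym [x == b]eq_sym [y == b]eq_sym.
move=> neq; case: (eqVneq a x) => ax; case: (eqVneq a y) => ay //=;
  case: (eqVneq b x) => bx; case: (eqVneq b y) => by_ //= *.
all: by move: neq; rewrite ?ax ?ay ?bx ?by_ ?eqxx.
Qed.

(** * Choice of the parameters and conclusion *)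

Local Open Scope ring_scope.

(** The least m with n ^ 2 <= r ^ m satisfies m <= 2L + 1 with
    L = ln n / ln r, and the next integer q after 2m/eps satisfies
    2q + 2 <= (8L + 4)/eps + 4 < (8L + 6)/eps, because eps < 1/2.  The
    hypothesis r ^ 3 <= n means L >= 3, so this is at most 10L/eps < r c. *)
Lemma exists_parameters (R : realType) (r : nat) (eps : R) (n c : nat) :
  (2 <= r)%N -> 0 < eps -> eps < r%:R^-1 -> (r ^ 3 <= n)%N ->
  10 * ln (n%:R : R) / (eps * r%:R * ln (r%:R : R)) < c%:R ->
  exists m q : nat, [/\ (0 < q)%N, (n ^ 2 <= r ^ m)%N,
    2 * m%:R <= eps * q%:R & (2 * q + 2 <= r.+1 * c)%N].
Proof.
move=> r_ge2 eps_gt0 eps_lt n_ge c_gt.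
have r_gt0 : 0 < r%:R :> R by rewrite ltr0n; lia.
have lnr_gt0 : 0 < ln (r%:R : R) by rewrite ln_gt0 // ltr1n.
have n_gt1 : (1 < n)%N.
  by apply: leq_trans n_ge; apply: (@leq_trans (2 ^ 3)); rewrite ?leq_exp2r.
have n_gt0 : 0 < n%:R :> R by rewrite ltr0n; lia.
have lnn_ge : 3 * ln (r%:R : R) <= ln n%:R.
  rewrite mulr_natl -lnXn // -natrX ler_ln ?posrE ?ler_nat //.
  by rewrite ltr0n expn_gt0; lia.
pose m := up_log r (n ^ 2).
have m_le : (m%:R - 1) * ln (r%:R : R) <= 2 * ln n%:R.
  have n2_gt1 : (1 < n ^ 2)%N by rewrite -(exp1n 2) ltn_exp2r.
  have m_gt0 : (0 < m)%N by rewrite up_log_gt0 r_ge2.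
  have := ltnW (up_log_gtn r_ge2 n2_gt1).
  rewrite -/m -(ler_nat R) !natrX -ler_ln ?posrE ?exprn_gt0 // !lnXn //.
  by rewrite -[_ *+ 2]mulr_natl -[_ *+ m.-1]mulr_natl -subn1 natrB.
exists m, (Num.truncn (2 * m%:R / eps)).+1.
have x_ge0 : 0 <= 2 * m%:R / eps by rewrite divr_ge0 ?mulr_ge0 // ltW.
have := truncn_itv x_ge0; move: (Num.truncn _) => t /andP[t_le t_gt].
split=> //; first by apply: up_logP.
  by rewrite [leRHS]mulrC -ler_pdivrMr // ltW.
suff : (2 * t.+1 + 2)%:R <= (r.+1 * c)%:R :> R by rewrite ler_nat.
set L := ln n%:R / ln (r%:R : R).
have L_ge3 : 3 <= L by rewrite ler_pdivlMr.
have m_leL : m%:R <= 2 * L + 1.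
  by rewrite -lerBlDr /L mulrA ler_pdivlMr.
have c_gtL : 10 * L < c%:R * r%:R * eps.
  move: c_gt; rewrite ltr_pdivrMr ?mulr_gt0 // /L mulrA.
  by rewrite ltr_pdivrMr //; lra.
have eps_lt1 : eps < 1 / 2.
  apply: lt_le_trans eps_lt _; rewrite div1r lef_pV2 ?posrE //.
  by rewrite ler_nat.
have t_leM : t%:R * eps <= 2 * m%:R by rewrite -ler_pdivlMr.
rewrite -(ler_pM2r eps_gt0) natrD !natrM -[t.+1%:R]natr1 -[r.+1%:R]natr1.
have ceps_ge0 : 0 <= c%:R * eps by rewrite mulr_ge0 // ltW.
have -> : (2 * (t%:R + 1) + 2) * eps = 2 * (t%:R * eps) + 4 * eps by ring.
have -> : (r%:R + 1) * c%:R * eps = c%:R * r%:R * eps + c%:R * eps by ring.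
lra.
Qed.

(** Markov's bound allows 4n/3 + 4mn^2/(3q) non-adjacent ordered pairs.  With
    m/q <= eps/2 and n >= 4/eps the two terms are at most 1/3 and 2/3 of
    eps n^2, which is the number of such pairs that may be lost. *)
Lemma not_forces_blowup (R : realType) (r : nat) (eps : R) (n c : nat) :
  (2 <= r)%N -> 0 < eps -> eps < r%:R^-1 -> (r ^ 3 <= n)%N -> 4 <= eps * n%:R ->
  10 * ln (n%:R : R) / (eps * r%:R * ln (r%:R : R)) < c%:R ->
  ~ forces_blowup n r (r%:R^-1 - eps) c.
Proof.
move=> r_ge2 eps_gt0 eps_lt n_ge n_large c_gt.
have [m [q [q_gt0 n2_le m_le q_le]]] :=
  exists_parameters r_ge2 eps_gt0 eps_lt n_ge c_gt.
have n_gt2 : (2 < n)%N.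
  by apply: leq_trans n_ge; apply: (@leq_trans (2 ^ 3)); rewrite ?leq_exp2r.
have n2_le' : (n ^ 2 <= r.+1 ^ m)%N.
  by apply: leq_trans n2_le _; case: (m) => // e; rewrite leq_exp2r.
have := @exists_unseparated_colorings 'I_n 'I_q m r.+1 c.
rewrite !card_ord => -[||||//|w [few_nonadj no_copy]] //; first by lia.
  by apply: leq_trans n2_le'; apply: (@leq_trans (3 ^ 2)); rewrite ?leq_exp2r.
move=> /(_ (differ_graph w)); case.
- exact: card_ord.
- have := card_adjacent_pairs (differ_graph w).
  set X := #|_| in few_nonadj; set A := #|_|; set E := #|_| => le_AE.
  have AX : (A + X = n ^ 2)%N.
    have := cardsC [set p : 'I_n * 'I_n | all_differ w p.1 p.2].
    rewrite card_prod !card_ord mulnn => <-.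
    by congr (_ + _); apply: eq_card => p; rewrite !inE.
  have {}few_nonadj :
      3 * q%:R * X%:R <= 4 * (n%:R * q%:R + m%:R * n%:R ^+ 2) :> R.
    by move: few_nonadj; rewrite -(ler_nat R) !natrM natrD !natrM expr2.
  have X_le : X%:R <= eps * n%:R ^+ 2.
    have q_gt0R : 0 < q%:R :> R by rewrite ltr0n.
    have n2_ge0 : 0 <= n%:R ^+ 2 :> R by rewrite exprn_ge0.
    have qn_ge0 : 0 <= q%:R * n%:R :> R by rewrite mulr_ge0.
    rewrite -(ler_pM2l q_gt0R); move: few_nonadj.
    have := ler_wpM2r n2_ge0 m_le; have := ler_wpM2l qn_ge0 n_large.
    have -> : q%:R * n%:R * (eps * n%:R) = q%:R * (eps * n%:R ^+ 2) by ring.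
    have -> : eps * q%:R * n%:R ^+ 2 = q%:R * (eps * n%:R ^+ 2) by ring.
    lra.
  have : n%:R ^+ 2 - X%:R <= 2 * E%:R :> R.
    by rewrite lerBlDr -natrX -AX -natrM -natrD ler_nat leq_add2r.
  by lra.
- move=> f f_inj f_adj.
  have [|g g_inj sep_g] := @differ_graph_copy _ _ _ w r.+1 c; first by exists f.
  by have := no_copy g g_inj; rewrite sep_g.
Qed.

Theorem proposition2 (R : realType) (r : nat) (eps : R) :
  (2 <= r)%N -> 0 < eps -> eps < r%:R^-1 ->
  exists n0 : nat, forall n : nat, (n0 < n)%N ->
    exists2 b : nat, is_bn n r (r%:R^-1 - eps) b
      & b%:R <= 10 * ln (n%:R : R) / (eps * r%:R * ln (r%:R : R)).
Proof.
move=> r_ge2 eps_gt0 eps_lt.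
exists (maxn (r ^ 3) (Num.truncn (4 / eps)).+1) => n.
rewrite gtn_max => /andP[n_ge n_large].
set bound := _ / _.
have forced_le c : forces_blowup n r (r%:R^-1 - eps) c -> c%:R <= bound.
  move=> forced; rewrite leNgt; apply/negP => c_gt.
  apply: (not_forces_blowup r_ge2 eps_gt0 eps_lt (ltnW n_ge) _ c_gt) => //.
  rewrite [leRHS]mulrC -ler_pdivrMr // ltW // (lt_trans (truncnS_gt _)) //.
  by rewrite ltr_nat.
have forces0 : forces_blowup n r (r%:R^-1 - eps) 0.
  move=> G _ _.
  have no_vertex (u : blowup r.+1 0) : False by case: u => _ [].
  by exists (fun u => False_rect _ (no_vertex u)) => u; case: (no_vertex u).
have [||b /asboolP forced_b b_max] :=
  @ex_maxnP (fun c => `[< forces_blowup n r (r%:R^-1 - eps) c >])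
    (Num.truncn bound).
- by exists 0%N; apply/asboolP.
- move=> c /asboolP/forced_le c_le.
  by rewrite truncn_ge_nat // (le_trans _ c_le).
exists b; last exact: forced_le.
by split=> // c forced_c; apply: b_max; apply/asboolP.
Qed.
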